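(* As $n\to\infty$ (over positive integers $n$), $$(2n+1)\sum_{k=0}^\infty\frac{\binom{2k}{k}}{2k+2n+1}\Bigl(\frac{x}{2}\Bigr)^{2k}\to\frac{1}{\sqrt{1-x^2}},$$ $$(2n+1)\sum_{k=1}^\infty\frac{(2x)^{2k-1}}{\binom{2k}{k}k(2k+2n)}\to\frac{\arcsin x}{\sqrt{1-x^2}},$$ uniformly in $x$ on compact subsets of the interval $(-1,1)$. *)

(* Defs.v *)
From Stdlib Require Import Reals.
From Coquelicot Require Import Coquelicot.

Open Scope R_scope.

(* [Binomial.C] is the binomial coefficient; a bare [C] would denote
   Coquelicot's type of complex numbers. *)
Definition term1 (n : nat) (x : R) (k : nat) : R :=
  Binomial.C (2 * k) k / INR (2 * k + 2 * n + 1) * (x / 2) ^ (2 * k).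

(* Only used for [1 <= k], where the truncated [2 * k - 1] is the true one. *)
Definition term2 (n : nat) (x : R) (k : nat) : R :=
  (2 * x) ^ (2 * k - 1) / (Binomial.C (2 * k) k * INR k * INR (2 * k + 2 * n)).

Definition cv_uniformly_on (K : R -> Prop) (f : nat -> R -> R) (g : R -> R) : Prop :=
  forall eps : R, 0 < eps ->
    exists N : nat, forall n : nat, (1 <= n)%nat -> (N <= n)%nat ->
      forall x : R, K x -> Rabs (f n x - g x) < eps.

(* Main.v *)
(* Both series are instances, with [N = 2n + 1], of the damped power series
   [N * sum_m c_m x^m / (m + N)], where [(m + 2) c_(m+2) = (m + 1) c_m]; the
   first has [(c_0, c_1) = (1, 0)] and the second [(0, 1)].  Since
   [|N / (m + N) - 1| <= m / N] and [|c_m| <= 1], for [|x| <= r < 1] the damped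
   series is within [(sum_m m r^m) / N] of [f = sum_m c_m x^m].  The recurrence
   says [(1 - x^2) f' - x f = c_1], so that [f sqrt (1 - x^2) - c_1 asin x] has
   zero derivative, and [f = (c_0 + c_1 asin x) / sqrt (1 - x^2)]. *)
Require Import Defs.
From Stdlib Require Import Reals Arith Lra Lia.
From Coquelicot Require Import Coquelicot.

Open Scope R_scope.

(** * Coefficients of the recurrence and the closed form of their power series *)

Fixpoint arc_coeff (a b : R) (m : nat) : R :=
  match m with
  | O => a
  | S p => match p with
           | O => b
           | S q => INR (S q) / INR (S (S q)) * arc_coeff a b q
           end
  end.

Lemma arc_coeff_SS (a b : R) (m : nat) :
  INR (S (S m)) * arc_coeff a b (S (S m)) = INR (S m) * arc_coeff a b m.
Proof.
  cbn [arc_coeff]. field. apply not_0_INR; lia.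
Qed.

(** Each step of two multiplies by [(m + 1) / (m + 2) < 1], so the bound passes from the two initial
    values to every coefficient. *)
Lemma arc_coeff_bounded (a b : R) (m : nat) :
  Rabs a <= 1 -> Rabs b <= 1 -> Rabs (arc_coeff a b m) <= 1.
Proof.
  intros Ha Hb; induction m as [m IHm] using lt_wf_ind.
  destruct m as [|[|m]]; [exact Ha | exact Hb |].
  assert (IH := IHm m ltac:(lia)).
  assert (H := arc_coeff_SS a b m).
  assert (Hm : 0 < INR (S m)) by (apply lt_0_INR; lia).
  apply (f_equal Rabs) in H; rewrite !Rabs_mult in H.
  rewrite (S_INR (S m)) in H.
  rewrite (Rabs_pos_eq (INR (S m) + 1)), (Rabs_pos_eq (INR (S m))) in H by lra.
  assert (H0 := Rabs_pos (arc_coeff a b (S (S m)))).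
  nra.
Qed.

Lemma CV_radius_ge_1 (c : nat -> R) (x : R) :
  (forall m, Rabs (c m) <= 1) -> Rabs x < 1 -> Rbar_lt (Rabs x) (CV_radius c).
Proof.
  intros Hc Hx. apply Rbar_lt_le_trans with 1; [exact Hx|].
  apply (CV_radius_bounded c). exists 1; intro m.
  rewrite pow1, Rmult_1_r; apply Hc.
Qed.

Lemma ex_pseries_bounded (c : nat -> R) (x : R) :
  (forall m, Rabs (c m) <= 1) -> Rabs x < 1 -> ex_pseries c x.
Proof.
  intros; now apply CV_radius_inside, CV_radius_ge_1.
Qed.

(** The recurrence reads [(m + 2) c_(m+2) = m c_m + c_m]: beyond its constant term [c_1 = b], the
    series of [f'] has the coefficients of [x (x f' + f)]. Solving [f' = b + x (x f' + f)] for [b]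
    gives the equation. *)
Lemma PSeries_arc_coeff_ode (a b x : R) :
  Rabs a <= 1 -> Rabs b <= 1 -> Rabs x < 1 ->
  (1 - x ^ 2) * PSeries (PS_derive (arc_coeff a b)) x
    - x * PSeries (arc_coeff a b) x = b.
Proof.
  intros Ha Hb Hx.
  assert (Hc : forall m, Rabs (arc_coeff a b m) <= 1)
    by (intro; now apply arc_coeff_bounded).
  assert (Hd : ex_pseries (PS_derive (arc_coeff a b)) x)
    by now apply ex_pseries_derive, CV_radius_ge_1.
  assert (H : PSeries (PS_derive (arc_coeff a b)) x
    = b + x * (x * PSeries (PS_derive (arc_coeff a b)) x + PSeries (arc_coeff a b) x)).
  { rewrite (PSeries_decr_1 _ _ Hd) at 1.
    rewrite <- (PSeries_incr_1 (PS_derive _)), <- PSeries_plus;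
      [| now apply ex_pseries_incr_1 | now apply ex_pseries_bounded].
    f_equal; [unfold PS_derive; simpl; ring|]. f_equal.
    apply PSeries_ext; intro m.
    unfold PS_decr_1, PS_derive, PS_plus, PS_incr_1.
    rewrite arc_coeff_SS.
    (* At [m = 0] the shifted series contributes the inserted [zero], which agrees with [m c_m]. *)
    destruct m as [|m]; [|rewrite (S_INR (S m))];
      unfold plus, zero; simpl; ring. }
  rewrite H at 1. nra.
Qed.

Lemma is_derive_asin (x : R) :
  -1 < x < 1 -> is_derive asin x (/ sqrt (1 - x ^ 2)).
Proof.
  intro Hx. apply is_derive_Reals.
  replace (/ sqrt (1 - x ^ 2)) with (derive_pt asin x (derivable_pt_asin x Hx)).
  - apply (derive_pt_eq_1 asin x _ (derivable_pt_asin x Hx)); reflexivity.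
  - rewrite derive_pt_asin. unfold Rsqr, Rdiv. rewrite Rmult_1_l.
    do 3 f_equal. ring.
Qed.

Lemma PSeries_arc_coeff (a b x : R) :
  Rabs a <= 1 -> Rabs b <= 1 -> -1 < x < 1 ->
  PSeries (arc_coeff a b) x = (a + b * asin x) / sqrt (1 - x ^ 2).
Proof.
  intros Ha Hb Hx.
  set (f := PSeries (arc_coeff a b)).
  set (g := fun t => f t * sqrt (1 - t ^ 2) - b * asin t).
  assert (Hpos : forall t, -1 < t < 1 -> 0 < sqrt (1 - t ^ 2))
    by (intros t Ht; apply sqrt_lt_R0; nra).
  assert (Hg : forall t, -1 < t < 1 -> is_derive g t 0).
  { intros t Ht.
    assert (Ht' : Rabs t < 1) by (apply Rabs_def1; lra).
    assert (Hf : is_derive f t (PSeries (PS_derive (arc_coeff a b)) t)).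
    { apply is_derive_PSeries, CV_radius_ge_1; [|exact Ht'].
      intro; now apply arc_coeff_bounded. }
    assert (Hs : is_derive (fun u => sqrt (1 - u ^ 2)) t (- t / sqrt (1 - t ^ 2))).
    { assert (H := Hpos t Ht).
      auto_derive; [nra|].
      unfold Rminus in *; simpl in *; field; lra. }
    assert (H := PSeries_arc_coeff_ode a b t Ha Hb Ht').
    assert (Hp := Hpos t Ht).
    assert (Hsq : sqrt (1 - t ^ 2) * sqrt (1 - t ^ 2) = 1 - t ^ 2)
      by (apply sqrt_sqrt; nra).
    evar_last.
    - apply @is_derive_minus.
      + apply @is_derive_mult; [exact Hf | exact Hs | intros; apply Rmult_comm].
      + apply @is_derive_scal, is_derive_asin, Ht.
    - unfold minus, plus, opp, mult, scal; simpl; unfold mult; simpl.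
      fold f in H. unfold f in *.
      set (s := sqrt (1 - t ^ 2)) in *.
      change (t * (t * 1)) with (t ^ 2); fold s.
      set (F := PSeries (arc_coeff a b) t) in *.
      set (D := PSeries (PS_derive (arc_coeff a b)) t) in *.
      (* Multiplied by [s], the derivative of [g] becomes [D * (s * s) - t * F - b]; since
         [s * s = 1 - t ^ 2], the differential equation makes it vanish. *)
      apply Rmult_eq_reg_r with s; [|lra].
      replace ((D * s + F * (- t / s) + - (b * / s)) * s)
        with (D * (s * s) - t * F - b) by (field; lra).
      rewrite Hsq. lra. }
  assert (Hc : g x - g 0 = 0).
  { destruct (MVT_gen g 0 x (fun _ => 0)) as [c [_ Hc]].
    - intros t Ht; apply Hg. revert Ht; unfold Rmin, Rmax.
      destruct (Rle_dec 0 x); lra.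
    - intros t Ht. apply continuity_pt_filterlim.
      apply @ex_derive_continuous; exists 0; apply Hg.
      revert Ht; unfold Rmin, Rmax; destruct (Rle_dec 0 x); lra.
    - rewrite Hc; ring. }
  assert (H0 : g 0 = a).
  { unfold g, f. rewrite PSeries_0, asin_0.
    replace (1 - 0 ^ 2) with 1 by ring. rewrite sqrt_1; simpl; ring. }
  rewrite H0 in Hc; unfold g in Hc.
  assert (Hp := Hpos x Hx).
  apply Rmult_eq_reg_r with (sqrt (1 - x ^ 2)); [|lra].
  unfold Rdiv; rewrite Rmult_assoc, Rinv_l by lra. lra.
Qed.

(** * Error of the damped series, uniformly on compact sets *)

Lemma Rabs_damped_le (c : nat -> R) (N m : nat) :
  (1 <= N)%nat -> Rabs (c m) <= 1 -> Rabs (c m / INR (m + N)) <= 1.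
Proof.
  intros HN Hc.
  assert (H : 1 <= INR (m + N)) by (apply (le_INR 1); lia).
  unfold Rdiv; rewrite Rabs_mult, Rabs_inv, (Rabs_pos_eq (INR _)) by lra.
  apply Rle_trans with (1 * / 1); [|lra].
  apply Rmult_le_compat; [apply Rabs_pos | | exact Hc | apply Rinv_le_contravar; lra].
  apply Rlt_le, Rinv_0_lt_compat; lra.
Qed.

(** The sequence [PS_incr_1 (PS_derive (fun _ => 1))] is [m], so the last factor is [sum_m m r^m];
    written as [r] times the derivative of the geometric series, it converges by the radius of the
    latter. The estimate is then made term by term. *)
Lemma damped_PSeries_error (c : nat -> R) (N : nat) (r x : R) :
  (1 <= N)%nat -> (forall m, Rabs (c m) <= 1) -> Rabs x <= r < 1 ->
  Rabs (INR N * PSeries (fun m => c m / INR (m + N)) x - PSeries c x)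
    <= / INR N * PSeries (PS_incr_1 (PS_derive (fun _ => 1))) r.
Proof.
  intros HN Hc [Hxr Hr].
  assert (Hx : Rabs x < 1) by lra.
  assert (Hr0 : 0 <= r) by (assert (H := Rabs_pos x); lra).
  assert (HN0 : 1 <= INR N) by (apply (le_INR 1); lia).
  assert (E1 : ex_series (fun m => c m * x ^ m))
    by now apply ex_pseries_R, ex_pseries_bounded.
  assert (E2 : ex_series (fun m => c m / INR (m + N) * x ^ m)).
  { apply (ex_pseries_R (fun m => c m / INR (m + N))).
    apply ex_pseries_bounded; [|exact Hx]. intro; now apply Rabs_damped_le. }
  assert (E3 : ex_series (fun m => PS_incr_1 (PS_derive (fun _ => 1)) m * r ^ m)).
  { apply ex_pseries_R, ex_pseries_incr_1, ex_pseries_derive, CV_radius_ge_1.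
    - intros _; rewrite Rabs_R1; lra.
    - rewrite Rabs_pos_eq; lra. }
  unfold PSeries.
  rewrite <- !Series_scal_l, <- Series_minus;
    [| now apply (ex_series_scal_l (V := R_NormedModule)) | exact E1].
  assert (Hle : forall m,
    0 <= Rabs (INR N * (c m / INR (m + N) * x ^ m) - c m * x ^ m)
      <= / INR N * (PS_incr_1 (PS_derive (fun _ => 1)) m * r ^ m)).
  { intro m; split; [apply Rabs_pos|].
    assert (Hm : 0 <= INR m) by apply pos_INR.
    rewrite plus_INR.
    (* This is [N / (m + N) - 1 = - m / (m + N)]; below, [m / (m + N) <= m / N] and
       [|c_m x^m| <= r^m]. *)
    replace (INR N * (c m / (INR m + INR N) * x ^ m) - c m * x ^ m)
      with (- (INR m / (INR m + INR N) * (c m * x ^ m))) by (field; lra).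
    rewrite Rabs_Ropp, !Rabs_mult, <- RPow_abs.
    replace (PS_incr_1 (PS_derive (fun _ => 1)) m) with (INR m)
      by (destruct m as [|m]; unfold PS_incr_1, PS_derive; [reflexivity|ring]).
    rewrite <- (Rmult_assoc (/ INR N)).
    apply Rmult_le_compat; [apply Rabs_pos | | |].
    - apply Rmult_le_pos; [apply Rabs_pos | apply pow_le, Rabs_pos].
    - rewrite Rabs_pos_eq by (apply Rdiv_le_0_compat; lra).
      unfold Rdiv; rewrite Rmult_comm. apply Rmult_le_compat_r; [exact Hm|].
      apply Rinv_le_contravar; lra.
    - rewrite <- (Rmult_1_l (r ^ m)).
      apply Rmult_le_compat; [apply Rabs_pos | apply pow_le, Rabs_pos | apply Hc |].
      apply pow_incr; split; [apply Rabs_pos | exact Hxr]. }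
  assert (E4 : ex_series (fun m => / INR N * (PS_incr_1 (PS_derive (fun _ => 1)) m * r ^ m)))
    by now apply (ex_series_scal_l (V := R_NormedModule)).
  eapply Rle_trans; [apply Series_Rabs | apply Series_le; [exact Hle | exact E4]].
  apply (ex_series_le (V := R_CompleteNormedModule)) with (2 := E4).
  intro m; unfold norm; simpl; unfold abs; simpl.
  rewrite Rabs_Rabsolu; apply Hle.
Qed.

(** A compact set is closed, so its complement contains discs of radii [d] and [e] around [1] and
    [-1]; hence [K] lies in [[-1 + e, 1 - d]]. *)
Lemma compact_in_symmetric_interval (K : R -> Prop) :
  compact K -> (forall x, K x -> -1 < x < 1) ->
  exists r, 0 <= r < 1 /\ forall x, K x -> Rabs x <= r.
Proof.
  intros HK H1.
  assert (Ho := compact_P2 K HK).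
  destruct (Ho 1) as [d Hd]; [intro H; apply H1 in H; lra|].
  destruct (Ho (-1)) as [e He]; [intro H; apply H1 in H; lra|].
  assert (Hd0 := cond_pos d); assert (He0 := cond_pos e).
  (* If [K] is empty, both radii may exceed [1]; the maximum with [0] keeps the witness
     nonnegative. *)
  exists (Rmax 0 (1 - Rmin d e)); split.
  - split; [apply Rmax_l|]. apply Rmax_lub_lt; [lra|].
    assert (H := Rmin_glb_lt _ _ _ Hd0 He0); lra.
  - intros x Hx. eapply Rle_trans; [|apply Rmax_r].
    assert (Hx1 := H1 x Hx).
    assert (Hl := Rmin_l d e); assert (Hr := Rmin_r d e).
    assert (Hxd : x <= 1 - d).
    { apply Rnot_lt_le; intro H. apply (Hd x); [|exact Hx].
      unfold disc; apply Rabs_def1; lra. }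
    assert (Hxe : -1 + e <= x).
    { apply Rnot_lt_le; intro H. apply (He x); [|exact Hx].
      unfold disc; apply Rabs_def1; lra. }
    apply Rabs_le; lra.
Qed.

Lemma damped_PSeries_cv_uniformly (c : nat -> R) (K : R -> Prop) :
  (forall m, Rabs (c m) <= 1) -> compact K -> (forall x, K x -> -1 < x < 1) ->
  cv_uniformly_on K
    (fun n x => INR (2 * n + 1) * PSeries (fun m => c m / INR (m + (2 * n + 1))) x)
    (PSeries c).
Proof.
  intros Hc HK H1 eps Heps.
  destruct (compact_in_symmetric_interval K HK H1) as [r [Hr HKr]].
  set (M := PSeries (PS_incr_1 (PS_derive (fun _ => 1))) r).
  (* The floor gives [Rabs M / eps < N + 1 <= 2n + 1], which is what makes the error bound smaller
     than [eps]. The absolute value supplies the nonnegative argument that the floor requires. *)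
  destruct (nfloor_ex (Rabs M / eps)) as [N [_ HN]].
  { apply Rdiv_le_0_compat; [apply Rabs_pos | exact Heps]. }
  exists (S N); intros n Hn1 Hn x Hx.
  eapply Rle_lt_trans.
  - apply damped_PSeries_error with (r := r); [lia | exact Hc |].
    split; [now apply HKr | lra].
  - fold M.
    assert (HnN : INR N + 1 <= INR (2 * n + 1))
      by (rewrite <- S_INR; apply le_INR; lia).
    assert (HN0 := pos_INR N).
    apply Rle_lt_trans with (/ INR (2 * n + 1) * Rabs M).
    + apply Rmult_le_compat_l; [apply Rlt_le, Rinv_0_lt_compat; lra | apply Rle_abs].
    + apply Rmult_lt_reg_l with (INR (2 * n + 1)); [lra|].
      rewrite <- Rmult_assoc, Rinv_r, Rmult_1_l by lra.
      apply Rlt_div_l; [exact Heps | lra].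
Qed.

(** * Coefficients in terms of central binomials *)

Lemma central_binomial_pos (k : nat) : 0 < Binomial.C (2 * k) k.
Proof.
  unfold Binomial.C. apply Rdiv_lt_0_compat; [|apply Rmult_lt_0_compat];
    apply INR_fact_lt_0.
Qed.

Lemma central_binomial_S (k : nat) :
  Binomial.C (2 * S k) (S k)
    = Binomial.C (2 * k) k * (2 * (2 * INR k + 1)) / (INR k + 1).
Proof.
  unfold Binomial.C.
  replace (2 * S k - S k)%nat with (S k) by lia.
  replace (2 * k - k)%nat with k by lia.
  replace (2 * S k)%nat with (S (S (2 * k))) by lia.
  rewrite !fact_simpl, !mult_INR, !S_INR, mult_INR; simpl (INR 2).
  assert (H := pos_INR k). assert (Hf := INR_fact_lt_0 k).
  field. split; lra.
Qed.

(** Both sides start at [1] and have successive ratios [(2k + 1) / (2k + 2)]. *)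
Lemma arc_coeff_even (k : nat) :
  arc_coeff 1 0 (2 * k) = Binomial.C (2 * k) k / 4 ^ k.
Proof.
  induction k as [|k IH].
  - unfold Binomial.C; simpl; field.
  - rewrite central_binomial_S.
    replace (2 * S k)%nat with (S (S (2 * k))) by lia.
    assert (Hk := pos_INR k).
    assert (H4 : 4 ^ k <> 0) by (apply pow_nonzero; lra).
    apply Rmult_eq_reg_l with (INR (S (S (2 * k)))); [|apply not_0_INR; lia].
    rewrite arc_coeff_SS, IH, !S_INR, mult_INR, <- tech_pow_Rmult; simpl (INR 2).
    field. lra.
Qed.

(** Both sides start at [1] and have successive ratios [(2k + 2) / (2k + 3)]. The binomial is taken
    at [S k] because the second series starts at index [1]. *)
Lemma arc_coeff_odd (k : nat) :
  arc_coeff 0 1 (2 * k + 1)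
    = 2 ^ (2 * k + 1) / (Binomial.C (2 * S k) (S k) * INR (S k)).
Proof.
  induction k as [|k IH].
  - unfold Binomial.C; simpl; field.
  - rewrite (central_binomial_S (S k)).
    assert (HC := central_binomial_pos (S k)).
    set (B := Binomial.C (2 * S k) (S k)) in *.
    replace (2 * S k + 1)%nat with (S (S (2 * k + 1))) by lia.
    assert (Hk := pos_INR k).
    apply Rmult_eq_reg_l with (INR (S (S (2 * k + 1)))); [|apply not_0_INR; lia].
    rewrite arc_coeff_SS, IH, !S_INR, plus_INR, mult_INR, <- !tech_pow_Rmult.
    simpl (INR 2); simpl (INR 1).
    field. repeat split; lra.
Qed.

Lemma arc_coeff_0_r (a : R) (k : nat) : arc_coeff a 0 (2 * k + 1) = 0.
Proof.
  induction k as [|k IH]; [reflexivity|].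
  replace (2 * S k + 1)%nat with (S (S (2 * k + 1))) by lia.
  cbn [arc_coeff]. rewrite IH; ring.
Qed.

Lemma arc_coeff_0_l (b : R) (k : nat) : arc_coeff 0 b (2 * k) = 0.
Proof.
  induction k as [|k IH]; [reflexivity|].
  replace (2 * S k)%nat with (S (S (2 * k))) by lia.
  cbn [arc_coeff]. rewrite IH; ring.
Qed.

(** * The two given series as damped power series *)

Lemma term1_arc_coeff (n : nat) (x : R) (k : nat) :
  term1 n x k = arc_coeff 1 0 (2 * k) / INR (2 * k + (2 * n + 1)) * (x ^ 2) ^ k.
Proof.
  unfold term1. rewrite arc_coeff_even, Nat.add_assoc, !pow_mult.
  replace ((x / 2) ^ 2) with (x ^ 2 * / 4) by field.
  rewrite Rpow_mult_distr, pow_inv. field.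
  split; [apply pow_nonzero; lra | apply not_0_INR; lia].
Qed.

(** With index [j + 1], the denominator [2 (j + 1) + 2n] splits as [(2j + 1) + (2n + 1)]. The factor
    [x] and the powers of [x ^ 2] match the odd half in [PSeries_odd_even]. *)
Lemma term2_arc_coeff (n : nat) (x : R) (j : nat) :
  term2 n x (S j)
    = x * (arc_coeff 0 1 (2 * j + 1) / INR (2 * j + 1 + (2 * n + 1)) * (x ^ 2) ^ j).
Proof.
  unfold term2. rewrite arc_coeff_odd.
  replace (2 * S j - 1)%nat with (2 * j + 1)%nat by lia.
  replace (2 * S j + 2 * n)%nat with (2 * j + 1 + (2 * n + 1))%nat by lia.
  rewrite Rpow_mult_distr, (pow_add x), <- pow_mult, pow_1.
  assert (H := central_binomial_pos (S j)).
  field. repeat split; first [lra | apply not_0_INR; lia].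
Qed.

(** The index map [s] lets one statement serve the even and the odd half; any selection of damped
    coefficients is still bounded by [1], and [x ^ 2 < 1]. *)
Lemma ex_pseries_damped_sub (c : nat -> R) (s : nat -> nat) (N : nat) (x : R) :
  (1 <= N)%nat -> (forall m, Rabs (c m) <= 1) -> -1 < x < 1 ->
  ex_pseries (fun k => c (s k) / INR (s k + N)) (x ^ 2).
Proof.
  intros HN Hc Hx. apply ex_pseries_bounded.
  - intro k; now apply (Rabs_damped_le c N (s k)).
  - rewrite Rabs_pos_eq; nra.
Qed.

Lemma Rabs_0_1_le : Rabs 0 <= 1 /\ Rabs 1 <= 1.
Proof.
  rewrite Rabs_R0, Rabs_R1; lra.
Qed.

(** Splitting the damped series by parity, the odd half vanishes because [c_1 = 0], and the even
    half is the given series term by term. *)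
Lemma Series_term1 (n : nat) (x : R) :
  -1 < x < 1 ->
  Series (fun k => term1 n x k)
    = PSeries (fun m => arc_coeff 1 0 m / INR (m + (2 * n + 1))) x.
Proof.
  intro Hx. destruct Rabs_0_1_le.
  assert (Hc : forall m, Rabs (arc_coeff 1 0 m) <= 1)
    by (intro; now apply arc_coeff_bounded).
  rewrite PSeries_odd_even.
  - rewrite (PSeries_ext (fun k => arc_coeff 1 0 (2 * k + 1) / _) (fun _ => 0)).
    + rewrite PSeries_const_0, Rmult_0_r, Rplus_0_r.
      apply Series_ext, term1_arc_coeff.
    + intro k; rewrite arc_coeff_0_r; apply Rmult_0_l.
  - apply (ex_pseries_damped_sub _ (fun k => 2 * k)%nat); [lia | exact Hc | exact Hx].
  - apply (ex_pseries_damped_sub _ (fun k => 2 * k + 1)%nat); [lia | exact Hc | exact Hx].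
Qed.

(** Here [c_0 = 0] kills the even half, and the outer factor [x] of the odd half is absorbed into
    its terms. *)
Lemma Series_term2 (n : nat) (x : R) :
  -1 < x < 1 ->
  Series (fun j => term2 n x (S j))
    = PSeries (fun m => arc_coeff 0 1 m / INR (m + (2 * n + 1))) x.
Proof.
  intro Hx. destruct Rabs_0_1_le.
  assert (Hc : forall m, Rabs (arc_coeff 0 1 m) <= 1)
    by (intro; now apply arc_coeff_bounded).
  rewrite PSeries_odd_even.
  - rewrite (PSeries_ext (fun k => arc_coeff 0 1 (2 * k) / _) (fun _ => 0)).
    + rewrite PSeries_const_0, Rplus_0_l. unfold PSeries.
      rewrite <- Series_scal_l. apply Series_ext, term2_arc_coeff.
    + intro k; rewrite arc_coeff_0_l; apply Rmult_0_l.
  - apply (ex_pseries_damped_sub _ (fun k => 2 * k)%nat); [lia | exact Hc | exact Hx].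
  - apply (ex_pseries_damped_sub _ (fun k => 2 * k + 1)%nat); [lia | exact Hc | exact Hx].
Qed.

Theorem corollary8p2 :
  (forall (n : nat) (x : R), (1 <= n)%nat -> -1 < x < 1 ->
     ex_series (fun k : nat => term1 n x k) /\
     ex_series (fun j : nat => term2 n x (S j))) /\
  (forall K : R -> Prop, compact K -> (forall x : R, K x -> -1 < x < 1) ->
     cv_uniformly_on K
       (fun n x => INR (2 * n + 1) * Series (fun k : nat => term1 n x k))
       (fun x => 1 / sqrt (1 - x ^ 2)) /\
     cv_uniformly_on K
       (fun n x => INR (2 * n + 1) * Series (fun j : nat => term2 n x (S j)))
       (fun x => asin x / sqrt (1 - x ^ 2))).
Proof.
  destruct Rabs_0_1_le as [A0 A1].
  assert (Hc : forall m, Rabs (arc_coeff 1 0 m) <= 1)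
    by (intro; now apply arc_coeff_bounded).
  assert (Hd : forall m, Rabs (arc_coeff 0 1 m) <= 1)
    by (intro; now apply arc_coeff_bounded).
  split.
  - intros n x _ Hx; split.
    + eapply ex_series_ext; [intro k; symmetry; apply term1_arc_coeff|].
      apply ex_pseries_R with (a := fun k => arc_coeff 1 0 (2 * k) / INR (2 * k + (2 * n + 1))).
      apply (ex_pseries_damped_sub _ (fun k => 2 * k)%nat); [lia | exact Hc | exact Hx].
    + eapply ex_series_ext; [intro k; symmetry; apply term2_arc_coeff|].
      apply (ex_series_scal_l (V := R_NormedModule)).
      apply ex_pseries_R
        with (a := fun k => arc_coeff 0 1 (2 * k + 1) / INR (2 * k + 1 + (2 * n + 1))).
      apply (ex_pseries_damped_sub _ (fun k => 2 * k + 1)%nat); [lia | exact Hd | exact Hx].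
  - intros K HK H1; split; intros eps Heps.
    + destruct (damped_PSeries_cv_uniformly _ K Hc HK H1 eps Heps) as [N HN].
      exists N; intros n Hn1 Hn x Hx.
      rewrite (Series_term1 n x) by now apply H1.
      replace (1 / sqrt (1 - x ^ 2)) with (PSeries (arc_coeff 1 0) x); [now apply HN|].
      rewrite PSeries_arc_coeff, Rmult_0_l, Rplus_0_r; auto.
    + destruct (damped_PSeries_cv_uniformly _ K Hd HK H1 eps Heps) as [N HN].
      exists N; intros n Hn1 Hn x Hx.
      rewrite (Series_term2 n x) by now apply H1.
      replace (asin x / sqrt (1 - x ^ 2)) with (PSeries (arc_coeff 0 1) x); [now apply HN|].
      rewrite PSeries_arc_coeff, Rmult_1_l, Rplus_0_l; auto.
Qed.
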